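(* Consider the repeated game described in the context and let $$a:=\limsup_{m\to\infty}\max\{a^{(m)}_1,\dots,a^{(m)}_n\}\in[0,\infty].$$ Suppose that $c+d<A$ and that $a^{(m)}_j\le a$ for all $m\ge1$ and $1\le j\le n$. Then the accumulated carbon emissions $K_m$ converge to $a$ as $m\to\infty$.
   Context: One-round game. There are $n\ge1$ firms; constants $A,b,c,d>0$ are given, as well as exogenous carbon $K_{ex}\ge0$ and numbers $\alpha_i^2\in[0,\infty)$ (a symbol: the second moment of a random variable $\alpha$ under firm $i$'s subjective belief). Firm $i$ chooses $r_i\in[0,1]$ (technology) and $q_i\in[0,\infty)$ (quantity), with the convention $r_i=0$ whenever $q_i=0$; its carbon emission is $k_i=r_iq_i$. With $Q_{-i}=\sum_{j\ne i}q_j$ and $K_{-i}=K_{ex}+\sum_{j\ne i}r_jq_j$, the expected profit of firm $i$ for a choice $(r,q)\in[0,1]\times[0,\infty)$ is $$(A-q-Q_{-i})^+\,q-b\alpha_i^2\,(rq+K_{-i})\,rq-(c+d-dr)\,q .$$ An equilibrium (Nash) is a profile $(r_j,q_j)_{1\le j\le n}$ such that for every $i$, $(r_i,q_i)$ maximizes firm $i$'s expected profit over $[0,1]\times[0,\infty)$. For all parameters there is a unique equilibrium. Repeated game. The game is played in rounds $m=1,2,\dots$ with the same $n,A,b,c,d$. In round $m$ the beliefs are $(\alpha_j^{(m)})^2\in[0,\infty)$, $1\le j\le n$; set $\beta_j^{(m)}=b(\alpha_j^{(m)})^2$ and $a_j^{(m)}=d/\beta_j^{(m)}$ (with $a_j^{(m)}=\infty$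 if $\beta_j^{(m)}=0$). Firms are myopic: in round $m$ the equilibrium of the one-round game with beliefs $(\alpha_j^{(m)})^2$ and exogenous carbon $K_{ex}=K_{m-1}$ is played, where $K_0=0$, and the accumulated carbon after round $m$ is $K_m=K_{m-1}+\sum_j r_j^{(m)}q_j^{(m)}$, with $(r_j^{(m)},q_j^{(m)})_j$ the equilibrium of round $m$. Convergence to $\infty$ is allowed. *)

(* Defs.v *)
From mathcomp Require Import all_boot all_order all_algebra.
From mathcomp Require Import all_classical all_reals all_analysis.
Set Implicit Arguments.
Unset Strict Implicit.
Unset Printing Implicit Defensive.
Import Order.TTheory GRing.Theory Num.Theory.
Import numFieldNormedType.Exports.
Local Open Scope ring_scope.

(* [alpha2 i] stands for the second moment of alpha under firm i's belief;
   it is a plain number, not the square of a given number. *)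
Definition profit (R : realType) (n : nat) (A b c d Kex : R)
    (alpha2 r q : 'I_n -> R) (i : 'I_n) (ri qi : R) : R :=
  let Qmi := \sum_(j < n | j != i) q j in
  let Kmi := Kex + \sum_(j < n | j != i) r j * q j in
  Num.max (A - qi - Qmi) 0 * qi
  - b * alpha2 i * (ri * qi + Kmi) * (ri * qi)
  - (c + d - d * ri) * qi.

(* Firms that produce nothing are assigned the technology 0; without this
   convention equilibria would not be unique. *)
Definition admissible (R : realType) (n : nat) (r q : 'I_n -> R) : Prop :=
  forall i, [/\ 0 <= r i <= 1, 0 <= q i & q i = 0 -> r i = 0].

Definition is_equilibrium (R : realType) (n : nat) (A b c d Kex : R)
    (alpha2 r q : 'I_n -> R) : Prop :=
  admissible r q /\
  forall (i : 'I_n) (r' q' : R), 0 <= r' <= 1 -> 0 <= q' ->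
    profit A b c d Kex alpha2 r q i r' q'
    <= profit A b c d Kex alpha2 r q i (r i) (q i).

(* Rounds are numbered from 1, so the values of [alpha2], [r] and [q] at
   index 0 are never used. *)
Fixpoint carbon_after (R : realType) (n : nat) (r q : nat -> 'I_n -> R)
    (m : nat) : R :=
  if m is m'.+1
  then carbon_after r q m' + \sum_(j < n) r m j * q m j
  else 0.

Definition is_myopic_play (R : realType) (n : nat) (A b c d : R)
    (alpha2 r q : nat -> 'I_n -> R) : Prop :=
  forall m, (1 <= m)%N ->
    is_equilibrium A b c d (carbon_after r q m.-1)
      (alpha2 m) (r m) (q m).

Definition threshold (R : realType) (b d alpha2 : R) : \bar R :=
  let beta := b * alpha2 in
  if beta == 0 then +oo%E else (d / beta)%:E.

(* The sequence below has an irrelevant term at m = 0, which does not affect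
   the limsup; -oo is the neutral element of the maximum over the n >= 1
   firms. *)
Definition limsup_threshold (R : realType) (n : nat) (b d : R)
    (alpha2 : nat -> 'I_n -> R) : \bar R :=
  limn_esup (fun m : nat =>
    \big[maxe/-oo%E]_(j < n) threshold b d (alpha2 m j)).

(* Main.v *)
Require Import Defs.
From mathcomp Require Import all_boot all_order all_algebra.
From mathcomp Require Import all_classical all_reals all_analysis.
From mathcomp Require Import ring lra.
Set Implicit Arguments.
Unset Strict Implicit.
Unset Printing Implicit Defensive.
Import Order.TTheory GRing.Theory Num.Theory.
Import numFieldNormedType.Exports.
Local Open Scope classical_set_scope.
Local Open Scope ring_scope.

(** The accumulated carbon can only increase, so it converges to its supremum
    in the extended reals, and two bounds on this supremum [l] are needed.

    Upper bound.  A firm that emits could switch to the technology 0 at the same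
    quantity.  That this does not pay means that the carbon [K] reached in the
    round satisfies [beta K <= d], that is, [K] is at most the threshold of that
    firm ([emitting_equilibrium_bound]).  Hence the carbon never climbs above
    the largest threshold.

    Lower bound.  Suppose that [l] is smaller than the limsup [a] of the largest
    thresholds.  Then [l] is finite and the emissions of a single round become
    arbitrarily small.  A firm that produces more than it emits does so only if
    the price covers the cost [c + d] of a clean unit; if there is no such firm,
    the total quantity equals the total emission, which is too small to bring
    the price below [c + d], because [c + d < A].  So the price is eventually at
    least [c + d] ([price_ge_clean_cost]).  At such a price every firm can still
    gain from emitting more, unless its marginal carbon cost is at least about
    [d] ([marginal_carbon_cost_ge]): up to small terms, [d <= beta l].  But
    infinitely often some firm has a threshold above a fixed real [L > l], so
    that [beta L <= d], and then [beta l <= d l / L] stays below [d]. *)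

(** * The one-round game *)

(** A firm may be thought of as choosing its emission [k'] and its quantity
    [q'] with [0 <= k' <= q']: only the emission enters the carbon term, and in
    these variables the two choices can be changed independently. *)
Lemma equilibrium_deviation (R : realType) (n : nat) (A b c d Kex : R)
    (alpha2 r q : 'I_n -> R) (i : 'I_n) (k' q' : R) :
  is_equilibrium A b c d Kex alpha2 r q -> 0 <= k' <= q' ->
  Num.max (A - \sum_(j < n) q j + q i - q') 0 * q'
    - b * alpha2 i * (Kex + \sum_(j < n) r j * q j - r i * q i + k') * k'
    + d * k' - (c + d) * q'
  <= Num.max (A - \sum_(j < n) q j) 0 * q i
    - b * alpha2 i * (Kex + \sum_(j < n) r j * q j) * (r i * q i)
    + d * (r i * q i) - (c + d) * q i.
Proof.
move=> [_ opt] /andP[k'0 k'q'].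
set K := Kex + _; set Q := \sum_(j < n) q j; set k := r i * q i.
have q'0 : 0 <= q' := le_trans k'0 k'q'.
(* With the convention [x / 0 = 0], the technology [k' / q'] is also the right
   one at [q' = 0]. *)
have rq' : k' / q' * q' = k'.
  have [q'z|q'n0] := eqVneq q' 0; last by rewrite divfK.
  by apply/eqP; rewrite q'z mulr0 eq_le k'0 -q'z k'q'.
have r'01 : 0 <= k' / q' <= 1.
  rewrite divr_ge0 //=; have [->|q'n0] := eqVneq q' 0.
    by rewrite invr0 mulr0.
  by rewrite ler_pdivrMr ?mul1r // lt_def q'n0.
have := opt i _ _ r'01 q'0; rewrite /profit /=.
have QE : Q = q i + \sum_(j < n | j != i) q j by rewrite /Q (bigD1 i).
have KE : K = Kex + (k + \sum_(j < n | j != i) r j * q j).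
  by rewrite /K (bigD1 i).
have -> : A - q' - \sum_(j < n | j != i) q j = A - Q + q i - q'.
  by rewrite QE; ring.
have -> : A - q i - \sum_(j < n | j != i) q j = A - Q by rewrite QE; ring.
rewrite !mulrBl -[d * (k' / q') * q']mulrA -[d * r i * q i]mulrA !rq' -/k.
have -> : k' + (Kex + \sum_(j < n | j != i) r j * q j) = K - k + k'.
  by rewrite KE; ring.
have -> : k + (Kex + \sum_(j < n | j != i) r j * q j) = K.
  by rewrite KE; ring.
lra.
Qed.

Lemma emission_bounds (R : realType) (n : nat) (r q : 'I_n -> R) (i : 'I_n) :
  admissible r q -> 0 <= r i * q i <= q i.
Proof.
by case/(_ i) => /andP[r0 r1] q0 _; rewrite mulr_ge0 //= ler_piMl.
Qed.

(** Dropping all emission of firm [i] at an unchanged quantity changes its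
    profit by [k (beta K - d)]. *)
Lemma emitting_equilibrium_bound (R : realType) (n : nat) (A b c d Kex : R)
    (alpha2 r q : 'I_n -> R) (i : 'I_n) :
  is_equilibrium A b c d Kex alpha2 r q -> 0 < r i * q i ->
  b * alpha2 i * (Kex + \sum_(j < n) r j * q j) <= d.
Proof.
move=> eqm k0; have /andP[_ kq] := emission_bounds i eqm.1.
have := equilibrium_deviation i (k' := 0) (q' := q i) eqm.
rewrite lexx (le_trans (ltW k0) kq) => /(_ isT).
rewrite addrK !mulr0 => dev.
rewrite -(ler_pM2r k0); lra.
Qed.

(** A firm that produces more than it emits could give up exactly its clean
    production; this would not lower the price, so the price covers [c + d].  If
    there is no such firm, the bound on the emissions is a bound on the
    quantities. *)
Lemma price_ge_clean_cost (R : realType) (n : nat) (A b c d Kex : R)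
    (alpha2 r q : 'I_n -> R) :
  0 < c -> 0 < d -> is_equilibrium A b c d Kex alpha2 r q ->
  \sum_(j < n) r j * q j <= A - (c + d) ->
  c + d <= A - \sum_(j < n) q j.
Proof.
move=> c0 d0 eqm small; set Q := \sum_(j < n) q j.
have [/existsP[i kq]|/existsPn dirty] := boolP [exists i, r i * q i < q i];
  last first.
  have -> : Q = \sum_(j < n) r j * q j.
    apply: eq_bigr => j _; apply/eqP; rewrite eq_le leNgt dirty.
    by have /andP[] := emission_bounds j eqm.1.
  by lra.
have /andP[k0 _] := emission_bounds i eqm.1.
have := equilibrium_deviation i (k' := r i * q i) (q' := r i * q i) eqm.
rewrite lexx k0 => /(_ isT); rewrite subrK -/Q => dev.
have lower : Num.max (A - Q) 0 <= Num.max (A - Q + q i - r i * q i) 0.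
  by rewrite ge_max !le_max lexx orbT andbT; apply/orP; left; lra.
have := ler_wpM2r k0 lower.
have cover : c + d <= Num.max (A - Q) 0.
  rewrite -(@ler_pM2r _ (q i - r i * q i)) ?subr_gt0 //; nra.
by move: cover; rewrite le_max => /orP[//|]; lra.
Qed.

Lemma le0_of_linear_le_quadratic (R : realFieldType) (s C e0 : R) :
  0 < e0 -> (forall e, 0 < e <= e0 -> e * s <= C * e ^+ 2) -> s <= 0.
Proof.
move=> e00 H; rewrite leNgt; apply/negP => s0.
pose t := s / (2 * (`|C| + 1)).
have C0 : 0 < `|C| + 1 by rewrite ltr_wpDl.
have t0 : 0 < t by rewrite divr_gt0 // mulr_gt0.
have m0 : 0 < Num.min e0 t by rewrite lt_min e00 t0.
have := H (Num.min e0 t); rewrite m0 ge_min lexx => /(_ isT).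
rewrite expr2 mulrCA ler_pM2l //; apply/negP; rewrite -ltNge.
have := ler_wpM2r (ltW m0) (ler_norm C).
have : Num.min e0 t <= t by rewrite ge_min lexx orbT.
have : t * (`|C| + 1) = s / 2 by rewrite /t; field; rewrite gt_eqF.
have := normr_ge0 C; nra.
Qed.

(** If clean units make no loss, a firm has two ways to emit slightly more: it
    replaces clean production by emitting production, or, if it has no clean
    production, it expands.  Neither pays only if the marginal carbon cost
    [beta (K + k)] is at least [d], in the second case up to the loss [k] that
    the lower price causes on the units already produced. *)
Lemma marginal_carbon_cost_ge (R : realType) (n : nat) (A b c d Kex : R)
    (alpha2 r q : 'I_n -> R) (i : 'I_n) :
  0 < c -> 0 < d -> is_equilibrium A b c d Kex alpha2 r q ->
  c + d <= A - \sum_(j < n) q j ->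
  d <= r i * q i
    + b * alpha2 i * (Kex + \sum_(j < n) r j * q j + r i * q i).
Proof.
move=> c0 d0 eqm; set K := Kex + _; set Q := \sum_(j < n) q j => price.
have /andP[k0 kq] := emission_bounds i eqm.1.
have dev k' q' : 0 <= k' <= q' -> _ :=
  @equilibrium_deviation R n A b c d Kex alpha2 r q i k' q' eqm.
move: dev; rewrite -/K -/Q.
set k := r i * q i in k0 kq *; set be := b * alpha2 i => dev.
have maxP : Num.max (A - Q) 0 = A - Q by apply/max_idPl; lra.
rewrite maxP in dev.
rewrite -subr_le0; move: kq; rewrite le_eqVlt => /orP[/eqP kq|kq].
- apply: (@le0_of_linear_le_quadratic _ _ (1 + be) 1) => // e /andP[e0 _].
  have := dev (k + e) (q i + e); rewrite -kq lexx => /(_ ltac:(lra)).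
  have : A - Q + k - (k + e) <= Num.max (A - Q + k - (k + e)) 0.
    by rewrite le_max lexx.
  set M := Num.max _ _ => MP dv.
  have : (A - Q - e) * (k + e) <= M * (k + e).
    by apply: ler_wpM2r; lra.
  nra.
- apply: (@le0_of_linear_le_quadratic _ _ be (q i - k)).
    by rewrite subr_gt0.
  move=> e /andP[e0 eq].
  have := dev (k + e) (q i) ltac:(lra).
  rewrite addrK maxP; nra.
Qed.

(** * Accumulated carbon *)

Lemma carbon_nondecreasing (R : realType) (n : nat) (A b c d : R)
    (alpha2 r q : nat -> 'I_n -> R) :
  is_myopic_play A b c d alpha2 r q ->
  {homo carbon_after r q : m p / (m <= p)%N >-> m <= p}.
Proof.
move=> play; apply: homo_leq => [//|x y z|m]; first exact: le_trans.
rewrite /= lerDl; apply: sumr_ge0 => j _.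
by have /andP[] := emission_bounds j (play m.+1 isT).1.
Qed.

(** The comparison of a real number with a threshold, in the form that avoids
    the division by [beta], which may be zero. *)
Lemma le_threshold (R : realType) (b d alpha2 x : R) :
  0 <= b * alpha2 ->  0 < d ->
  (x%:E <= threshold b d alpha2)%E = (b * alpha2 * x <= d).
Proof.
move=> be0 d0; rewrite /threshold; have [->|ben0] := eqVneq (b * alpha2) 0.
  by rewrite leey mul0r ltW.
by rewrite lee_fin ler_pdivlMr ?lt_def ?ben0 // mulrC.
Qed.

(** Carbon grows only in rounds in which somebody emits, and then it does not
    pass the threshold of the emitting firm. *)
Lemma carbon_le_threshold_bound (R : realType) (n : nat) (A b c d : R)
    (alpha2 r q : nat -> 'I_n -> R) (a : \bar R) :
  0 < b -> 0 < d ->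
  (forall m, (1 <= m)%N -> forall j, 0 <= alpha2 m j) ->
  is_myopic_play A b c d alpha2 r q -> (0 <= a)%E ->
  (forall m, (1 <= m)%N -> forall j, (threshold b d (alpha2 m j) <= a)%E) ->
  forall m, ((carbon_after r q m)%:E <= a)%E.
Proof.
move=> b0 d0 al0 play a0 bound; elim=> [//|m IHm].
have eqm := play m.+1 isT.
have [/existsP[j kj]|/existsPn none] :=
    boolP [exists j, 0 < r m.+1 j * q m.+1 j].
  apply: le_trans (bound m.+1 isT j); rewrite le_threshold //.
    exact: emitting_equilibrium_bound eqm kj.
  by rewrite mulr_ge0 ?al0 ?ltW.
rewrite /= big1 ?addr0 // => j _; apply/eqP.
have /andP[k0 _] := emission_bounds j eqm.1.
by rewrite eq_le k0 leNgt none.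
Qed.

Lemma limn_esup_gt_frequently (R : realType) (u : (\bar R)^nat) (x : \bar R) :
  (x < limn_esup u)%E -> forall N, exists2 m, (N <= m)%N & (x < u m)%E.
Proof.
move=> xu N.
have : (x < ereal_sup (u @` [set m | (N <= m)%N]))%E.
  apply: lt_le_trans xu _; apply: ereal_inf_lbound.
  by exists [set m | (N <= m)%N] => //; exists N.
by move/ereal_sup_gt => [_ [m Nm <-] xum]; exists m.
Qed.

Lemma limsup_threshold_frequently (R : realType) (n : nat) (b d : R)
    (alpha2 : nat -> 'I_n -> R) (x : R) :
  (x%:E < limsup_threshold b d alpha2)%E ->
  forall N, exists m j, (N <= m)%N /\ (x%:E < threshold b d (alpha2 m j))%E.
Proof.
move=> /limn_esup_gt_frequently H N; have [m Nm] := H N.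
have [/existsP[j xj] _|/existsPn none] :=
    boolP [exists j, (x%:E < threshold b d (alpha2 m j))%E].
  by exists m, j.
rewrite ltNge => /negP[]; apply: bigmax_le => [|j _]; first exact: leNye.
by rewrite leNgt none.
Qed.

(** A finite bound [l] on the carbon caps the thresholds that occur in
    arbitrarily late rounds: the emissions of a late round are too small to
    keep the marginal carbon cost of a firm with a higher threshold near
    [d]. *)
Lemma limsup_threshold_le_carbon_sup (R : realType) (n : nat) (A b c d l : R)
    (alpha2 r q : nat -> 'I_n -> R) :
  0 < b -> 0 < c -> 0 < d -> c + d < A ->
  (forall m, (1 <= m)%N -> forall j, 0 <= alpha2 m j) ->
  is_myopic_play A b c d alpha2 r q ->
  ereal_sup (range (fun m => (carbon_after r q m)%:E)) = l%:E ->
  (limsup_threshold b d alpha2 <= l%:E)%E.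
Proof.
move=> b0 c0 d0 cdA al0 play supl.
have Kl m : carbon_after r q m <= l.
  by rewrite -lee_fin -supl; apply: ereal_sup_ubound; exists m.
have l0 : 0 <= l := Kl 0%N.
apply/lee_addgt0Pr => x x0; rewrite -EFinD leNgt; apply/negP => freq.
set L := l + x in freq.
(* The second term of the minimum makes [eta * (L + d)] smaller than
   [d * (L - l)]. *)
pose eta := Num.min (A - (c + d)) (d * x / (2 * (L + d))).
have L0 : 0 < L by rewrite /L; lra.
have Ld0 : 0 < L + d by rewrite addr_gt0.
have eta0 : 0 < eta.
  rewrite lt_min subr_gt0 cdA /= divr_gt0 ?mulr_gt0 //.
have [N KN] : exists N, l - eta < carbon_after r q N.
  have : ((l - eta)%:E < ereal_sup (range (fun m => (carbon_after r q m)%:E)))%E.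
    by rewrite supl lte_fin; lra.
  by move=> /ereal_sup_gt[_ [N _ <-]]; rewrite lte_fin; exists N.
have [[|m] [j [Nm Lj]]] := limsup_threshold_frequently freq N.+1; first by [].
have eqm := play m.+1 isT.
have KNm := carbon_nondecreasing play (Nm : (N <= m)%N).
have := Kl m.+1; rewrite /=; set k := \sum_(j < n) _ => Klm.
have keta : k <= eta by clear -KN KNm Klm; lra.
have etaA : eta <= A - (c + d) by rewrite ge_min lexx.
have price := price_ge_clean_cost c0 d0 eqm (le_trans keta etaA).
have kj : r m.+1 j * q m.+1 j <= eta.
  apply: le_trans keta; rewrite /k (bigD1 j) //= lerDl; apply: sumr_ge0 => i _.
  by have /andP[] := emission_bounds i eqm.1.
have be0 : 0 <= b * alpha2 m.+1 j by rewrite mulr_ge0 ?al0 ?ltW.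
have := marginal_carbon_cost_ge j c0 d0 eqm price.
move: (ltW Lj); rewrite le_threshold // -/k.
move: (b * alpha2 m.+1 j) (r m.+1 j * q m.+1 j) be0 kj => be kj be0 kj_eta.
move=> beL marginal.
have cost : be * (carbon_after r q m + k + kj) <= be * (l + eta).
  by apply: ler_wpM2l => //; lra.
have etaLd : eta * (L + d) <= d * x / 2.
  have -> : d * x / 2 = d * x / (2 * (L + d)) * (L + d).
    by field; rewrite gt_eqF.
  by rewrite ler_pM2r // ge_min lexx orbT.
have : d * L <= (eta + be * (l + eta)) * L.
  by apply: ler_wpM2r; [exact: ltW|lra].
have : be * L * (l + eta) <= d * (l + eta) by apply: ler_wpM2r; lra.
have : 0 < d * x by rewrite mulr_gt0.
rewrite /L in etaLd *; nra.
Qed.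

Theorem proposition5p1 (R : realType) (n : nat) (A b c d : R)
    (alpha2 r q : nat -> 'I_n -> R)
    (hn : (1 <= n)%N)
    (hA : 0 < A) (hb : 0 < b) (hc : 0 < c) (hd : 0 < d)
    (halpha2 : forall m, (1 <= m)%N -> forall j, 0 <= alpha2 m j)
    (hplay : is_myopic_play A b c d alpha2 r q)
    (hcd : c + d < A)
    (hle : forall m, (1 <= m)%N -> forall j,
       (threshold b d (alpha2 m j) <= limsup_threshold b d alpha2)%E) :
  (carbon_after r q m)%:E @[m --> \oo] --> limsup_threshold b d alpha2.
Proof.
set a := limsup_threshold b d alpha2.
have a0 : (0 <= a)%E.
  apply: le_trans (hle 1%N isT (Ordinal hn)).
  by rewrite le_threshold ?mulr0 ?(ltW hd) // mulr_ge0 ?halpha2 // ltW.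
have Ka := carbon_le_threshold_bound hb hd halpha2 hplay a0 hle.
have /ereal_nondecreasing_cvgn :
    nondecreasing_seq (fun m => (carbon_after r q m)%:E).
  by move=> m p mp; rewrite lee_fin; apply: (carbon_nondecreasing hplay).
suff -> : ereal_sup (range (fun m => (carbon_after r q m)%:E)) = a by [].
apply/eqP; rewrite eq_le; apply/andP; split.
  by apply: ge_ereal_sup => _ [m _ <-].
have K0 : (0 <= ereal_sup (range (fun m => (carbon_after r q m)%:E)))%E.
  by apply: ereal_sup_ubound; exists 0%N.
case supl : (ereal_sup _) K0 => [l| |] // _; last exact: leey.
exact: limsup_threshold_le_carbon_sup hb hc hd hcd halpha2 hplay supl.
Qed.
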